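(* Let $(G_n)$ be a family of connected graphs, where $G_n$ has $n$ vertices and $n$ ranges over an infinite set of positive integers, such that the maximum degree satisfies $\Delta(G_n)=n-O(1)$, i.e. there is a constant $C$ with $\Delta(G_n)\geq n-C$ for all $n$. Then $\mathcal{K}(G_n)=O(n)$. Consequently, if the complements $\overline{G_n}$ are connected, then $\mathcal{K}(G_n)\mathcal{K}(\overline{G_n})=O(n^4)$.
   Context: Graphs are finite, simple, undirected and unweighted. $\overline{G}$ is the complement of $G$. For a connected graph $G$ with vertex set $\{1,\dots,n\}$, $m$ edges and vertex degrees $d_1,\dots,d_n$, Kemeny's constant is $\mathcal{K}(G)=\sum_{j\neq i}\frac{d_j}{2m}\,m_{i,j}$, where $m_{i,j}$ is the expected first time at which the simple random walk on $G$ (which moves at each step to a uniformly random neighbour) started at $i$ reaches $j$; this value does not depend on the choice of $i$. Asymptotic notation: $f(G_n)=O(g(n))$ means $\limsup_{n\to\infty} f(G_n)/g(n)$ is finite. *)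

(* Defs.v *)
From HB Require Import structures.
From mathcomp Require Export all_boot all_order all_algebra.
From mathcomp Require Export all_classical all_reals all_analysis.
Export Order.TTheory GRing.Theory Num.Theory.
Export numFieldNormedType.Exports.

Set Implicit Arguments.
Unset Strict Implicit.
Unset Printing Implicit Defensive.

Local Open Scope classical_set_scope.
Local Open Scope ring_scope.

Record sgraph (V : finType) := SGraph {
  adj : rel V;
  adj_sym : symmetric adj;
  adj_irr : irreflexive adj }.

Section Graph.
Variables (V : finType) (G : sgraph V).

Definition degree (x : V) : nat := #|[set y : V | adj G x y]%SET|.

Definition max_degree : nat := (\max_(x : V) degree x)%N.

Definition edges : {set {set V}} :=
  [set [set p.1; p.2]%SET | p : V * V & adj G p.1 p.2]%SET.

Definition graph_connected : Prop := forall x y : V, connect (adj G) x y.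

Definition compl_adj : rel V := fun x y => (x != y) && ~~ adj G x y.

Lemma compl_adj_sym : symmetric compl_adj.
Proof. by move=> x y; rewrite /compl_adj eq_sym adj_sym. Qed.

Lemma compl_adj_irr : irreflexive compl_adj.
Proof. by move=> x; rewrite /compl_adj eqxx. Qed.

Definition compl_graph : sgraph V := SGraph compl_adj_sym compl_adj_irr.

End Graph.

Section RandomWalk.
Variables (R : realType) (V : finType) (G : sgraph V).

Definition step_prob (x y : V) : R :=
  if adj G x y then (degree G x)%:R^-1 else 0.

(* Probability that the first steps of the walk started at [x] are exactly
   the successive vertices of [s]. *)
Fixpoint walk_prob (x : V) (s : seq V) : R :=
  if s is y :: s' then step_prob x y * walk_prob y s' else 1.

(* Probability that the walk started at [i] reaches [j] for the first time at
   time [t]: the trajectory [i :: p] has times 0, ..., t, and [index] is the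
   first position at which [j] occurs (it is t + 1 if [j] does not occur). *)
Definition hit_prob (i j : V) (t : nat) : R :=
  \sum_(p : t.-tuple V | index j (i :: p) == t) walk_prob i p.

(* Expectation of the hitting time T in {0, 1, ..., +oo}: the last term is
   +oo * P(T = +oo), which is 0 when [j] is reached almost surely. *)
Definition mean_hitting_time (i j : V) : \bar R :=
  (\sum_(0 <= t <oo) (t%:R * hit_prob i j t)%:E
   + +oo * (1 - \sum_(0 <= t <oo) (hit_prob i j t)%:E))%E.

Definition kemeny_from (i : V) : \bar R :=
  (\sum_(j : V | j != i)
     ((degree G j)%:R / (2 * #|edges G|%:R))%:E * mean_hitting_time i j)%E.

(* For connected graphs [kemeny_from i] does not depend on [i], so an arbitrary
   starting vertex is used; the value 0 is for the graph with no vertices. *)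
Definition kemeny : \bar R :=
  if [pick i : V] is Some i then kemeny_from i else 0%E.

End RandomWalk.

(* f(n) = O(g(n)) as n tends to infinity within S. *)
Definition bigO_on (R : realType) (S : set nat) (f : nat -> \bar R)
    (g : nat -> R) : Prop :=
  limf_esup (fun n => f n * ((g n)^-1)%:E)%E (within S \oo) \is a fin_num.

(* Main.v *)
From HB Require Import structures.
Require Import Defs.
From mathcomp Require Import ring lra zify.

(** The expected hitting times of [j] are bounded by the solution [h_j] of
    their first-step equations, which in terms of the graph Laplacian read
    L h_j = deg - vol * 1_j with h_j(j) = 0, where vol is the sum of the degrees.
    A solution exists because the Laplacian of a connected graph is injective
    once grounded at [j] ([hitting_potential_exists]), and it dominates the
    expected hitting times because it dominates all their truncations
    ([mean_hitting_time_le]). Hence Kemeny's constant is at most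
    sum_j (d_j / vol) h_j(i), and this sum does not depend on the start [i] since
    it is a harmonic function of [i] ([random_target]).

    Take for start a vertex [v] of maximum degree. The commute time
    T_j = h_j(v) + h_v(j) is estimated electrically: phi = h_j - h_v carries a
    current of strength vol from [v] to [j], so its Dirichlet energy, summed over
    ordered pairs, is 2 vol T_j ([flow_energy]), while T_j = phi(v) - phi(j).
    Cauchy-Schwarz along a path of length l gives T_j <= 2 vol l
    ([commute_le_path]), and over k paths of length two in parallel
    it gives T_j <= 4 vol / k ([commute_le_common_neighbours]).

    Let c be the number of vertices outside the neighbourhood of [v]; it is
    bounded. If d_j >= 2c, then [j] and [v] have at least d_j / 2 common
    neighbours, so d_j T_j <= 8 vol. If d_j < 2c, then [j] is within
    distance c of [v] ([short_path]), so d_j T_j <= 4 c^2 vol. Summing over the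
    n vertices, Kemeny's constant is at most (8 + 4 c^2) n
    ([kemeny_le_codegree]). For the complement, the path bound alone gives 2 n^3
    ([kemeny_le_cubic]), whence the product is O(n^4). *)

Set Implicit Arguments.
Unset Strict Implicit.
Unset Printing Implicit Defensive.

Local Open Scope classical_set_scope.
Local Open Scope ring_scope.

(** * Laplacian and Dirichlet energy of a finite graph *)

Section Laplacian.
Variables (R : realType) (V : finType) (G : sgraph V).
Implicit Types (f g : V -> R) (x y j v : V).

Definition laplacian f x : R := \sum_(y | adj G x y) (f x - f y).

Definition local_energy f x : R := \sum_(y | adj G x y) (f x - f y) ^+ 2.

(** The Dirichlet form; ordered pairs count each edge twice. *)
Definition energy f : R := \sum_x local_energy f x.

Definition volume : R := \sum_x (degree G x)%:R.

Lemma volume_ge0 : 0 <= volume.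
Proof. by apply: sumr_ge0. Qed.

Lemma degreeE x : degree G x = (\sum_(y | adj G x y) 1)%N.
Proof.
by rewrite /degree -sum1_card; apply: eq_bigl => y; rewrite inE.
Qed.

Lemma laplacianE f x :
  laplacian f x = (degree G x)%:R * f x - \sum_(y | adj G x y) f y.
Proof.
rewrite /laplacian sumrB degreeE natr_sum mulr_suml; congr (_ - _).
by apply: eq_bigr => y _; rewrite mul1r.
Qed.

Lemma laplacianB f g x :
  laplacian (fun y => f y - g y) x = laplacian f x - laplacian g x.
Proof. by rewrite /laplacian -sumrB; apply: eq_bigr => y _; ring. Qed.

Lemma laplacianZ a f x :
  laplacian (fun y => a * f y) x = a * laplacian f x.
Proof. by rewrite /laplacian mulr_sumr; apply: eq_bigr => y _; ring. Qed.

Lemma laplacian_sum (I : finType) (F : I -> V -> R) x :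
  laplacian (fun y => \sum_i F i y) x = \sum_i laplacian (F i) x.
Proof.
rewrite /laplacian exchange_big /=; apply: eq_bigr => y _.
by rewrite sumrB.
Qed.

Lemma sum_adjC (F : V -> V -> R) :
  \sum_x \sum_(y | adj G x y) F x y = \sum_x \sum_(y | adj G x y) F y x.
Proof.
rewrite (exchange_big_dep predT) //=; apply: eq_bigr => x _.
by apply: eq_bigl => y; rewrite adj_sym.
Qed.

Lemma sum_laplacian f : \sum_x laplacian f x = 0.
Proof.
have skew : \sum_x laplacian f x = - \sum_x laplacian f x.
  rewrite [LHS]sum_adjC -sumrN; apply: eq_bigr => x _.
  by rewrite /laplacian -sumrN; apply: eq_bigr => y _; rewrite opprB.
lra.
Qed.

(** Summation by parts. *)
Lemma energyE f : energy f = 2 * \sum_x f x * laplacian f x.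
Proof.
have E : \sum_x f x * laplacian f x =
    \sum_x \sum_(y | adj G x y) f x * (f x - f y).
  by apply: eq_bigr => x _; rewrite mulr_sumr.
have -> : 2 * (\sum_x f x * laplacian f x) =
    \sum_x f x * laplacian f x + \sum_x f x * laplacian f x by ring.
rewrite E {2}sum_adjC -big_split; apply: eq_bigr => x _ /=.
by rewrite -big_split; apply: eq_bigr => y _ /=; ring.
Qed.

Lemma local_energy_ge0 f x : 0 <= local_energy f x.
Proof. by apply: sumr_ge0 => y _; exact: sqr_ge0. Qed.

Lemma sqr_edge_le_local_energy f x y :
  adj G x y -> (f x - f y) ^+ 2 <= local_energy f x.
Proof.
move=> xy; rewrite /local_energy (bigD1 y) //= lerDl.
by apply: sumr_ge0 => z _; exact: sqr_ge0.
Qed.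

(** What lets edges along a path, or at two vertices, be charged to the total
    energy: distinct vertices have disjoint sets of ordered incident pairs. *)
Lemma sum_local_energy_le f (s : seq V) :
  uniq s -> \sum_(x <- s) local_energy f x <= energy f.
Proof.
move=> us; rewrite big_uniq //= /energy [leRHS](bigID (mem s)) /=.
by rewrite lerDl; apply: sumr_ge0 => x _; exact: local_energy_ge0.
Qed.

Lemma local_energyD_le f x y :
  x != y -> local_energy f x + local_energy f y <= energy f.
Proof.
move=> xy; have := @sum_local_energy_le f [:: x; y].
rewrite big_cons big_seq1; apply.
by rewrite /= inE xy.
Qed.

(** The length factor is Cauchy-Schwarz along the path; as its vertices are
    distinct, each local energy is spent at most once. *)
Lemma path_energy f x (p : seq V) : path (adj G) x p -> uniq (x :: p) ->
  (f x - f (last x p)) ^+ 2 <= (size p)%:R * energy f.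
Proof.
have CS : forall s x, path (adj G) x s -> (f x - f (last x s)) ^+ 2 <=
    (size s)%:R * \sum_(y <- belast x s) local_energy f y.
  elim=> [|y s IHs] z /=; first by rewrite subrr expr0n big_nil mulr0.
  move=> /andP[zy ps]; rewrite big_cons.
  have := IHs _ ps; have := sqr_edge_le_local_energy f zy.
  set a := local_energy f z; set b := \sum_(i <- _) _.
  rewrite -natr1; set l : R := (size s)%:R.
  have l0 : 0 <= l by exact: ler0n.
  set u := f z - f y; set w := f y - f (last y s) => ua wb.
  have -> : f z - f (last y s) = u + w by rewrite /u /w; ring.
  have [lz|lz] := eqVneq l 0.
    have w0 : w = 0.
      by apply/eqP; rewrite -sqrf_eq0 eq_le sqr_ge0 (le_trans wb) ?lz ?mul0r.
    have b0 : 0 <= b by apply: sumr_ge0 => i _; exact: local_energy_ge0.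
    rewrite w0 lz; lra.
  have lp : 0 < l by rewrite lt_def lz.
  (* The Cauchy-Schwarz induction step, multiplied by [l] to clear the
     denominator of (u + w)^2 <= (l + 1) (u^2 + w^2 / l). *)
  have key : l * (u + w) ^+ 2 <= l * ((l + 1) * (a + b)).
    have -> : l * (u + w) ^+ 2 =
        (l + 1) * (l * u ^+ 2 + w ^+ 2) - (l * u - w) ^+ 2 by ring.
    have -> : l * ((l + 1) * (a + b)) = (l + 1) * (l * a + l * b) by ring.
    have : (l + 1) * (l * u ^+ 2 + w ^+ 2) <= (l + 1) * (l * a + l * b).
      apply: ler_wpM2l; first by lra.
      by apply: lerD => //; apply: ler_wpM2l.
    have := sqr_ge0 (l * u - w); lra.
  by rewrite -(ler_pM2l lp).
move=> px ux; apply: le_trans (CS _ _ px) _; rewrite ler_wpM2l //.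
by apply: sum_local_energy_le; rewrite lastI rcons_uniq in ux; case/andP: ux.
Qed.

(** The paths of length two through the common neighbours run in parallel: each
    of them sees the whole difference [f x - f y], on edges of its own. *)
Lemma common_neighbours_energy f x y : x != y ->
  #|[set z | adj G x z && adj G y z]%SET|%:R * (f x - f y) ^+ 2
    <= 2 * energy f.
Proof.
move=> xy; set W := [set z | _]%SET.
have sub t : {in W, forall z, adj G t z} ->
    \sum_(z in W) (f t - f z) ^+ 2 <= local_energy f t.
  move=> tW; rewrite /local_energy [leRHS](bigID (mem W)) /=.
  rewrite -[leLHS]addr0 lerD //; last by apply: sumr_ge0 => z _; exact: sqr_ge0.
  rewrite le_eqVlt; apply/orP; left; apply/eqP; apply: eq_bigl => z.
  by case: (boolP (z \in W)) => [/tW ->|]; rewrite ?andbF.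
have sx := sub x (fun z => ltac:(by rewrite inE => /andP[])).
have sy := sub y (fun z => ltac:(by rewrite inE => /andP[])).
rewrite -sum1_card natr_sum mulr_suml.
apply: le_trans (_ : 2 * (\sum_(z in W) (f x - f z) ^+ 2 +
                          \sum_(z in W) (f y - f z) ^+ 2) <= _).
  rewrite -big_split mulr_sumr; apply: ler_sum => z _ /=.
  have := sqr_ge0 ((f x - f z) + (f y - f z)); lra.
by rewrite ler_wpM2l //; have := local_energyD_le f xy; lra.
Qed.

(** Zero energy forces a function to be constant along every edge. *)
Lemma harmonic_const f : graph_connected G ->
  (forall x, laplacian f x = 0) -> forall x y, f x = f y.
Proof.
move=> Gc f0 x y.
have e0 : energy f = 0.
  by rewrite energyE big1 ?mulr0 // => z _; rewrite f0 mulr0.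
case/connectP: (Gc x y) => p0 /shortenP[p px up _] ->.
have := path_energy f px up; rewrite e0 mulr0 => h.
by apply/eqP; rewrite -subr_eq0 -sqrf_eq0 eq_le h sqr_ge0.
Qed.

End Laplacian.

(** * Hitting potentials and commute times *)

Lemma le_of_sqr_le_mul (R : realType) (a b : R) :
  0 <= a -> 0 <= b -> a ^+ 2 <= b * a -> a <= b.
Proof. by rewrite le_eqVlt => /predU1P[<- //|a0] _; rewrite expr2 ler_pM2r. Qed.

Section HittingPotential.
Variables (R : realType) (V : finType) (G : sgraph V).
Hypothesis G_conn : graph_connected G.
Implicit Types (f h : V -> R) (x y i j v : V).

Local Notation vol := (volume R G).

Lemma degree_gt0 x y : x != y -> (0 < degree G x)%N.
Proof.
move=> xy; case/connectP: (G_conn x y) => [[|z p] /=].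
  by move=> _ yx; rewrite yx eqxx in xy.
by case/andP=> xz _ _; rewrite card_gt0; apply/set0Pn; exists z; rewrite inE.
Qed.

Lemma all_degree_gt0 x y z : x != y -> (0 < degree G z)%N.
Proof.
move=> xy; have [->|zx] := eqVneq z x; first exact: (degree_gt0 xy).
exact: (degree_gt0 zx).
Qed.

Lemma volume_gt0 x y : x != y -> 0 < vol.
Proof.
move=> xy; rewrite /volume (bigD1 x) //=.
by rewrite ltr_wpDr ?sumr_ge0 // ltr0n (degree_gt0 xy).
Qed.

(** Adding the value at [j] makes the Laplacian injective, hence surjective in
    finite dimension, and forces solutions to vanish at [j]. *)
Definition grounded j (f : {ffun V -> R^o}) : {ffun V -> R^o} :=
  [ffun x => laplacian G f x + (x == j)%:R * f j].

Lemma grounded_is_linear j : linear (grounded j).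
Proof.
move=> a f g; apply/ffunP => x; rewrite !ffunE.
have -> : laplacian G (a *: f + g) x = a * laplacian G f x + laplacian G g x.
  rewrite /laplacian mulr_sumr -big_split /=; apply: eq_bigr => y _.
  by rewrite !ffunE /GRing.scale /=; ring.
by rewrite /GRing.scale /=; ring.
Qed.

HB.instance Definition _ j := GRing.isLinear.Build R _ _ _ (grounded j)
  (grounded_is_linear j).

Lemma grounded_inj j : injective (grounded j).
Proof.
move=> f g /ffunP fg.
pose d y : R := f y - g y.
have d0 x : laplacian G d x + (x == j)%:R * d j = 0.
  have := fg x; rewrite !ffunE laplacianB /d => e.
  by rewrite mulrBr; move: e; set a := _ * f j; set b := _ * g j; lra.
have dj : d j = 0.
  (* Summing over all vertices kills the Laplacian. *)
  have : \sum_x (laplacian G d x + (x == j)%:R * d j) = 0 by rewrite big1.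
  rewrite big_split /= sum_laplacian add0r -mulr_suml (bigD1 j) //= eqxx.
  by rewrite big1 ?addr0 ?mul1r // => x /negbTE ->.
have lap0 x : laplacian G d x = 0 by have := d0 x; rewrite dj mulr0 addr0.
apply/ffunP => x; apply/eqP; rewrite -subr_eq0 -/(d x).
by rewrite (harmonic_const G_conn lap0 x j) dj.
Qed.

(** The equations satisfied by the expected hitting times of [j]: first-step
    analysis off [j], and at [j] the value that makes the total zero. *)
Definition hitting_potential j h :=
  h j = 0 /\ forall x, laplacian G h x = (degree G x)%:R - vol * (x == j)%:R.

Lemma hitting_potential_exists j : exists h, hitting_potential j h.
Proof.
pose A := linfun (grounded j).
have kerA : lker A == 0%VS.
  by apply/lker0P => f g; rewrite !lfunE /=; exact: grounded_inj.
pose b : {ffun V -> R^o} := [ffun x => (degree G x)%:R - vol * (x == j)%:R].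
pose h := (A^-1)%VF b.
have Ah : grounded j h = b by rewrite -[LHS](lfunE _ h) lker0_lfunVK.
have hx x : laplacian G h x + (x == j)%:R * h j =
    (degree G x)%:R - vol * (x == j)%:R.
  by move/ffunP: Ah => /(_ x); rewrite !ffunE.
have sumj (a : R) : \sum_x a * (x == j)%:R = a.
  rewrite (bigD1 j) //= eqxx mulr1 big1 ?addr0 // => x /negbTE ->.
  by rewrite mulr0.
(* Both sides of the defining equation, summed over all vertices. *)
have hj : h j = 0.
  have : \sum_x (laplacian G h x + h j * (x == j)%:R) =
      \sum_x ((degree G x)%:R - vol * (x == j)%:R).
    by apply: eq_bigr => x _; rewrite [h j * _]mulrC hx.
  by rewrite big_split sumrB /= sum_laplacian !sumj add0r subrr.
by exists h; split=> // x; rewrite -hx hj mulr0 addr0.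
Qed.

(** At a minimum other than [j] the Laplacian would be nonpositive, whereas it
    equals the positive degree there. *)
Lemma hitting_potential_ge0 j h x : hitting_potential j h -> 0 <= h x.
Proof.
move=> [hj hL]; case: (arg_minP h (erefl : xpredT j)) => m _ hm.
have [mj|mj] := eqVneq m j; first by rewrite -hj -mj hm.
have := hL m; rewrite (negbTE mj) mulr0 subr0 => e.
have : laplacian G h m <= 0.
  by apply: sumr_le0 => y _; rewrite subr_le0 hm.
by rewrite e lern0 eqn0Ngt (degree_gt0 mj).
Qed.

Lemma step_prob_ge0 x y : 0 <= step_prob R G x y.
Proof. by rewrite /step_prob; case: ifP => // _; rewrite invr_ge0. Qed.

Lemma sum_step_prob x : (0 < degree G x)%N -> \sum_y step_prob R G x y = 1.
Proof.
move=> dx; rewrite /step_prob -big_mkcond /= sumr_const.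
rewrite (_ : #|_| = degree G x); last by apply: eq_card => y; rewrite !inE.
by rewrite -[LHS]mulr_natr mulVf // pnatr_eq0 -lt0n.
Qed.

Lemma hitting_potential_step j h x : hitting_potential j h -> x != j ->
  h x = 1 + \sum_y step_prob R G x y * h y.
Proof.
move=> [_ hL] xj; have := hL x; rewrite (negbTE xj) mulr0 subr0 laplacianE.
have d0 : (degree G x)%:R != 0 :> R by rewrite pnatr_eq0 -lt0n (degree_gt0 xj).
have -> : \sum_y step_prob R G x y * h y =
    (degree G x)%:R^-1 * \sum_(y | adj G x y) h y.
  rewrite mulr_sumr [RHS]big_mkcond /=; apply: eq_bigr => y _.
  by rewrite /step_prob; case: ifP => // _; rewrite mul0r.
move=> e; apply: (mulfI d0); rewrite mulrDr mulr1 mulrA divff // mul1r.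
by apply/eqP; rewrite -subr_eq e.
Qed.

(** The random target lemma: the weighted sum of the potentials is harmonic,
    since the weights are the degrees and these add up to the volume. *)
Lemma random_target (h : V -> V -> R) i v :
  (forall j, hitting_potential j (h j)) ->
  \sum_j (degree G j)%:R * h j i = \sum_j (degree G j)%:R * h j v.
Proof.
move=> hh.
pose F x := \sum_j (degree G j)%:R * h j x.
apply: (harmonic_const (f := F) G_conn) => x.
rewrite (laplacian_sum G (fun j y => (degree G j)%:R * h j y)).
under eq_bigr => j _ do rewrite laplacianZ (hh j).2 mulrBr.
rewrite sumrB -mulr_suml -/vol [X in _ - X](bigD1 x) //= eqxx mulr1.
rewrite [X in _ - (_ + X)]big1 ?addr0; first by rewrite mulrC subrr.
by move=> j jx; rewrite eq_sym (negbTE jx) !mulr0.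
Qed.

Section Commute.
Variables (v j : V) (hv hj : V -> R).
Hypothesis (hvP : hitting_potential v hv) (hjP : hitting_potential j hj).

Local Notation commute := (hj v + hv j).
Local Notation flow := (fun x => hj x - hv x).

Lemma commute_ge0 : 0 <= commute.
Proof.
rewrite addr_ge0 ?(hitting_potential_ge0 _ hjP) //.
exact: hitting_potential_ge0 hvP.
Qed.

Lemma flow_drop : flow v - flow j = commute.
Proof. by rewrite /= hvP.1 hjP.1; ring. Qed.

(** The difference of the two potentials is harmonic off [v] and [j], where it
    has a source and a sink of strength [volume]; the degrees cancel. *)
Lemma flow_energy : energy G flow = 2 * vol * commute.
Proof.
rewrite energyE -mulrA; congr (_ * _).
have L x : flow x * laplacian G flow x =
    flow x * vol * (x == v)%:R - flow x * vol * (x == j)%:R.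
  by rewrite laplacianB hvP.2 hjP.2; ring.
have pick k : \sum_x flow x * vol * (x == k)%:R = flow k * vol.
  rewrite (bigD1 k) //= eqxx mulr1 big1 ?addr0 // => x /negbTE ->.
  by rewrite mulr0.
rewrite (eq_bigr _ (fun x _ => L x)) sumrB !pick -mulrBl flow_drop; ring.
Qed.

(** The square of the commute time is at most the length times the energy, and
    the energy is itself linear in the commute time. *)
Lemma commute_le_path (p : seq V) :
  path (adj G) v p -> uniq (v :: p) -> last v p = j ->
  commute <= 2 * vol * (size p)%:R.
Proof.
move=> pv up pj; have := path_energy flow pv up.
rewrite pj flow_drop flow_energy => h.
apply: le_of_sqr_le_mul; first exact: commute_ge0.
  by rewrite !mulr_ge0 // volume_ge0.
by move: h; lra.
Qed.

Lemma commute_le_common_neighbours : v != j ->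
  #|[set z | adj G v z && adj G j z]%SET|%:R * commute <= 4 * vol.
Proof.
move=> vj; have := common_neighbours_energy G flow vj.
rewrite flow_drop flow_energy; set k : R := _%:R => h.
have k0 : 0 <= k by exact: ler0n.
apply: le_of_sqr_le_mul; first by rewrite mulr_ge0 ?commute_ge0.
  by rewrite !mulr_ge0 // volume_ge0.
have := ler_wpM2l k0 h; move: commute => c; lra.
Qed.

End Commute.
End HittingPotential.

(** * Mean hitting times of the random walk *)

Section HittingTime.
Variables (R : realType) (V : finType) (G : sgraph V).
Implicit Types (i j x y : V) (n t : nat).

Local Notation P := (step_prob R G).
Local Notation a := (hit_prob R G).

Lemma hit_prob0 i j : a i j 0 = (i == j)%:R.
Proof.
rewrite /hit_prob big_mkcond /= (bigD1 [tuple]) //= big1 => [|p]; last first.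
  by rewrite tuple0.
by rewrite addr0 /=; case: (i == j).
Qed.

Lemma hit_prob_self j t : a j j t.+1 = 0.
Proof. by rewrite /hit_prob big_pred0 // => p; rewrite /= eqxx. Qed.

Lemma sum_tuple_cons t (F : seq V -> R) :
  \sum_(p : t.+1.-tuple V) F p = \sum_y \sum_(q : t.-tuple V) F (y :: q).
Proof.
rewrite pair_bigA /=.
rewrite (reindex (fun u : V * t.-tuple V => [tuple of u.1 :: u.2])) //=.
exists (fun p : t.+1.-tuple V => (thead p, [tuple of behead p])).
  move=> [y q] _ /=.
  by rewrite theadE; congr (_, _); apply: val_inj.
by move=> p _ /=; rewrite -tuple_eta.
Qed.

Lemma hit_probS i j t : i != j -> a i j t.+1 = \sum_y P i y * a y j t.
Proof.
move=> ij; rewrite /hit_prob big_mkcond /=.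
rewrite (sum_tuple_cons _ (fun p => if index j (i :: p) == t.+1
   then walk_prob R G i p else 0)).
apply: eq_bigr => y _; rewrite mulr_sumr [RHS]big_mkcond /=.
by apply: eq_bigr => q _; rewrite (negbTE ij) eqSS.
Qed.

Lemma walk_prob_ge0 i (s : seq V) : 0 <= walk_prob R G i s.
Proof. by elim: s i => //= y s IHs i; rewrite mulr_ge0 ?step_prob_ge0. Qed.

Lemma hit_prob_ge0 i j t : 0 <= a i j t.
Proof. by apply: sumr_ge0 => p _; exact: walk_prob_ge0. Qed.

Hypothesis deg_gt0 : forall x, (0 < degree G x)%N.

Lemma sum_hit_prob_le1 i j n : \sum_(t < n) a i j t <= 1.
Proof.
elim: n i => [|n IHn] i; first by rewrite big_ord0.
rewrite big_ord_recl hit_prob0; have [->|ij] := eqVneq i j.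
  by rewrite big1 ?addr0 // => t _; rewrite hit_prob_self.
rewrite add0r; under eq_bigr => t _ do rewrite hit_probS //.
rewrite exchange_big /= -(sum_step_prob R (deg_gt0 i)).
apply: ler_sum => y _; rewrite -mulr_sumr ler_piMr ?step_prob_ge0 //.
Qed.

(** The expectation of the minimum of the hitting time and [n]. Unlike the
    partial sums of the mean, it controls the unreached mass as well. *)
Definition truncated_mean i j n : R :=
  \sum_(t < n) t%:R * a i j t + n%:R * (1 - \sum_(t < n) a i j t).

Lemma truncated_mean_self j n : truncated_mean j j n = 0.
Proof.
rewrite /truncated_mean; case: n => [|n]; first by rewrite !big_ord0; ring.
rewrite !big_ord_recl hit_prob0 eqxx mul0r !big1 ?addr0 ?subrr ?mulr0 ?addr0 //.
  by move=> t _; rewrite hit_prob_self.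
by move=> t _; rewrite hit_prob_self mulr0.
Qed.

Lemma truncated_meanS i j n : i != j ->
  truncated_mean i j n.+1 = 1 + \sum_y P i y * truncated_mean y j n.
Proof.
move=> ij; rewrite /truncated_mean !big_ord_recl hit_prob0 (negbTE ij) mulr0.
rewrite !add0r.
have E1 : \sum_(t < n) a i j (bump 0 t) = \sum_y P i y * \sum_(t < n) a y j t.
  under eq_bigr => t _ do rewrite hit_probS //.
  by rewrite exchange_big /=; apply: eq_bigr => y _; rewrite -mulr_sumr.
have E2 : \sum_(t < n) (bump 0 t)%:R * a i j (bump 0 t) =
    \sum_y P i y * (\sum_(t < n) t%:R * a y j t + \sum_(t < n) a y j t).
  under eq_bigr => t _ do rewrite hit_probS // mulr_sumr.
  rewrite exchange_big /=; apply: eq_bigr => y _; rewrite -big_split mulr_sumr.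
  by apply: eq_bigr => t _ /=; rewrite /bump /= add1n -natr1; ring.
rewrite E1 E2; have S1 := sum_step_prob R (deg_gt0 i).
have -> : n.+1%:R * (1 - \sum_y P i y * \sum_(t < n) a y j t) =
    \sum_y P i y * (n.+1%:R * (1 - \sum_(t < n) a y j t)).
  rewrite -[X in X - _]S1 -sumrB mulr_sumr; apply: eq_bigr => y _; ring.
rewrite -big_split -[X in X + \sum_y _]S1 -big_split.
by apply: eq_bigr => y _ /=; rewrite -natr1; ring.
Qed.

(** Induction on [n] by first-step analysis: supersolutions of the hitting time
    equations dominate the truncated means uniformly in [n]. *)
Lemma truncated_mean_le j (h : V -> R) : (forall x, 0 <= h x) ->
  (forall x, x != j -> 1 + \sum_y P x y * h y <= h x) ->
  forall n x, truncated_mean x j n <= h x.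
Proof.
move=> h0 hS; elim=> [|n IHn] x.
  by rewrite /truncated_mean !big_ord0 mul0r addr0.
have [->|xj] := eqVneq x j; first by rewrite truncated_mean_self.
rewrite truncated_meanS //; apply: le_trans (hS x xj); rewrite lerD2l.
by apply: ler_sum => y _; rewrite ler_wpM2l ?step_prob_ge0.
Qed.

Lemma series_hit_prob_le1 i j : (\sum_(0 <= t <oo) (a i j t)%:E <= 1)%E.
Proof.
apply: lime_le.
  by apply: is_cvg_nneseries => t _ _; rewrite lee_fin hit_prob_ge0.
apply: nearW => n; rewrite big_mkord sumEFin lee_fin; exact: sum_hit_prob_le1.
Qed.

Lemma mean_hitting_time_ge0 i j : (0 <= mean_hitting_time R G i j)%E.
Proof.
apply: adde_ge0.
  by apply: nneseries_ge0 => t _ _; rewrite lee_fin mulr_ge0 ?hit_prob_ge0.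
by apply: mule_ge0 => //; rewrite sube_ge0 ?series_hit_prob_le1 // orbT.
Qed.

(** The uniform bound on the truncated means bounds the series of the mean and
    also shows that the target is reached almost surely, so that the infinite
    term vanishes. *)
Lemma mean_hitting_time_le j (h : V -> R) : (forall x, 0 <= h x) ->
  (forall x, x != j -> 1 + \sum_y P x y * h y <= h x) ->
  forall i, (mean_hitting_time R G i j <= (h i)%:E)%E.
Proof.
move=> h0 hS i; have le_h := truncated_mean_le h0 hS.
have ta_ge0 n : 0 <= \sum_(t < n) t%:R * a i j t.
  by apply: sumr_ge0 => t _; rewrite mulr_ge0 ?hit_prob_ge0.
have tail_ge0 n : 0 <= n%:R * (1 - \sum_(t < n) a i j t) :> R.
  by rewrite mulr_ge0 // subr_ge0 sum_hit_prob_le1.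
have mean_le : (\sum_(0 <= t <oo) (t%:R * a i j t)%:E <= (h i)%:E)%E.
  apply: lime_le.
    by apply: is_cvg_nneseries => t _ _; rewrite lee_fin mulr_ge0 ?hit_prob_ge0.
  apply: nearW => n; rewrite big_mkord sumEFin lee_fin.
  by have := le_h n i; have := tail_ge0 n; rewrite /truncated_mean; lra.
have mass : (\sum_(0 <= t <oo) (a i j t)%:E = 1)%E.
  apply/eqP; rewrite eq_le series_hit_prob_le1 /=.
  have ge_n n : ((\sum_(t < n) a i j t)%:E <= \sum_(0 <= t <oo) (a i j t)%:E)%E.
    rewrite -sumEFin -(big_mkord xpredT (fun t => (a i j t)%:E)).
    by apply: nneseries_lim_ge => t _ _; rewrite lee_fin hit_prob_ge0.
  move: (series_hit_prob_le1 i j) ge_n.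
  case: (limn _) => [s | |] //=; last first.
    by move=> _ /(_ 0%N); rewrite leeNy_eq.
  rewrite !lee_fin => s1 ge_n; rewrite leNgt; apply/negP => s_lt1.
  (* The mass still missing after [n] steps is at most [h i / n]. *)
  have [n hn] : exists n : nat, h i / (1 - s) < n%:R.
    exists (Num.bound (h i / (1 - s))).
    by apply: archi_boundP; rewrite divr_ge0 // subr_ge0.
  rewrite ltr_pdivrMr ?subr_gt0 // in hn.
  have := ge_n n; have := le_h n i; have := ta_ge0 n.
  rewrite /truncated_mean lee_fin.
  set A := \sum_(t < n) _; set B := \sum_(t < n) _ => A0 AB Bs.
  have : n%:R * (1 - s) <= n%:R * (1 - B) :> R.
    by rewrite ler_wpM2l // lerD2l lerN2.
  lra.
by rewrite /mean_hitting_time mass subee // mule0 adde0.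
Qed.

End HittingTime.

(** * Bounds on Kemeny's constant *)

Section KemenyBounds.
Variables (R : realType) (V : finType) (G : sgraph V).
Hypothesis G_conn : graph_connected G.
Implicit Types (i j v : V).

Local Notation vol := (volume R G).

(** Half of the handshake lemma: an edge comes from at most two ordered
    pairs. *)
Lemma volume_le_edges : vol <= 2 * #|edges G|%:R.
Proof.
rewrite /volume -natr_sum -natrM ler_nat.
pose A := [set p : V * V | adj G p.1 p.2]%SET.
have -> : (\sum_x degree G x)%N = (\sum_(p in A) 1)%N.
  under eq_bigr => x _ do rewrite degreeE.
  by rewrite pair_big_dep; apply: eq_bigl => p; rewrite inE.
pose f (p : V * V) := [set p.1; p.2]%SET.
have -> : edges G = (f @: A)%SET by [].
rewrite (partition_big_imset f) /= mulnC -sum_nat_const.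
apply: leq_sum => e /imsetP[[x y] _ ->].
rewrite sum1_card.
apply: leq_trans (_ : #|[set (x, y); (y, x)]%SET| <= _)%N; last first.
  by rewrite cards2; case: eqP.
apply: subset_leq_card; apply/fintype.subsetP => -[z w].
rewrite !inE /= => /andP[Azw /eqP/setP E]; rewrite !xpair_eqE.
have zw : z != w by apply: contraTneq Azw => ->; rewrite inE /= adj_irr.
have := E z; have := E w; have := E x; have := E y.
rewrite !inE !eqxx ?orbT [_ == z]eq_sym [y == w]eq_sym.
rewrite [x == w]eq_sym [x == z]eq_sym /=.
have [zx|zx] := eqVneq z x; have [zy|zy] := eqVneq z y;
  have [wx|wx] := eqVneq w x; have [wy|wy] := eqVneq w y => //=.
all: by subst; rewrite ?eqxx in zw wx wy zx zy *.
Qed.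

Lemma kemeny_ge0 : (0 <= kemeny R G)%E.
Proof.
rewrite /kemeny; case: pickP => // i _; apply: sume_ge0 => j ji.
rewrite mule_ge0 // ?lee_fin ?divr_ge0 ?mulr_ge0 //.
by apply: mean_hitting_time_ge0 => x; exact: all_degree_gt0 ji.
Qed.

(** Kemeny's constant is defined from an arbitrary start; the random target
    lemma moves the start to any chosen [v]. *)
Lemma kemeny_le_hitting_potential (h : V -> V -> R) v :
  (forall j, hitting_potential G j (h j)) ->
  (kemeny R G <= ((\sum_j (degree G j)%:R * h j v) / vol)%:E)%E.
Proof.
move=> hP; have h_ge0 j x : 0 <= h j x by apply: hitting_potential_ge0 (hP j).
have vol_ge0 := volume_ge0 R G.
rewrite /kemeny; case: pickP => [i _|/(_ v)//].
rewrite -(random_target G_conn i v hP) mulr_suml -sumEFin.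
rewrite [leRHS](bigID (fun j => j != i)) /= -[leLHS]adde0.
apply: leeD; last first.
  by apply: sume_ge0 => j _; rewrite lee_fin divr_ge0 ?mulr_ge0.
apply: lee_sum => j ji.
have dpos x : (0 < degree G x)%N by exact: all_degree_gt0 ji.
rewrite mulrAC [X in (_ <= X)%E]EFinM; apply: lee_pmul.
- by rewrite lee_fin divr_ge0 ?mulr_ge0.
- exact: mean_hitting_time_ge0.
- rewrite lee_fin ler_wpM2l // lef_pV2 ?posrE ?volume_le_edges //.
    exact: lt_le_trans (volume_gt0 R G_conn ji) volume_le_edges.
  exact: volume_gt0 ji.
- apply: mean_hitting_time_le => // x xj.
  by rewrite [leRHS](hitting_potential_step G_conn (hP j) xj).
Qed.

(** It is enough that the commute time between [v] and each [j] is at most a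
    constant times the inverse of the stationary probability of [j]. *)
Lemma kemeny_le_commute v (B : R) : 0 <= B ->
  (forall j hv hj, j != v -> hitting_potential G v hv ->
     hitting_potential G j hj ->
     (degree G j)%:R * (hj v + hv j) <= B * vol) ->
  (kemeny R G <= (B * #|V|%:R)%:E)%E.
Proof.
move=> B0 hB; have [h hP] := choice (hitting_potential_exists R G_conn).
apply: le_trans (kemeny_le_hitting_potential v hP) _; rewrite lee_fin.
have vol_ge0 := volume_ge0 R G.
have [vol0|vol_neq0] := eqVneq vol 0.
  by rewrite vol0 invr0 mulr0 mulr_ge0.
rewrite ler_pdivrMr ?lt_def ?vol_neq0 //.
have -> : B * #|V|%:R * vol = \sum_(j : V) B * vol.
  by rewrite sumr_const -mulr_natr; ring.
apply: ler_sum => j _; have [->|jv] := eqVneq j v.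
  by rewrite (hP v).1 mulr0 mulr_ge0.
apply: le_trans (hB j (h v) (h j) jv (hP v) (hP j)).
by rewrite ler_wpM2l // lerDl; apply: hitting_potential_ge0 (hP v).
Qed.

(** Commute times are at most twice the volume times the distance, hence cubic
    in the number of vertices, and Kemeny's constant is at most the largest of
    those with [v]. *)
Lemma kemeny_le_cubic : (kemeny R G <= (2 * #|V|%:R ^+ 3)%:E)%E.
Proof.
have [v _|V0] := pickP (@predT V); last first.
  rewrite /kemeny; case: pickP => [v|_]; last by rewrite lee_fin mulr_ge0.
  by have := V0 v.
have -> : 2 * #|V|%:R ^+ 3 = (2 * #|V|%:R ^+ 2) * #|V|%:R :> R by ring.
apply: (@kemeny_le_commute v); first by rewrite mulr_ge0.
move=> j hv hj jv hvP hjP.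
case/connectP: (G_conn v j) => p0 /shortenP[p pv up _] pj.
have cp := commute_le_path G_conn hvP hjP pv up (esym pj).
have c_ge0 := commute_ge0 G_conn hvP hjP.
have sp : (size p)%:R <= #|V|%:R :> R.
  rewrite ler_nat; have := max_card (mem (v :: p)).
  by rewrite (card_uniqP up) => /ltnW.
have dj : (degree G j)%:R <= #|V|%:R :> R by rewrite ler_nat max_card.
have vol_ge0 := volume_ge0 R G.
apply: le_trans (ler_pM _ _ dj (le_trans cp (ler_wpM2l _ sp))) _ => //.
  by rewrite mulr_ge0.
lra.
Qed.

(** A path from [v] may be cut at its last visit to the neighbourhood of [v] and
    started again by the edge to that neighbour; from then on it only uses
    vertices outside the neighbourhood. *)
Lemma short_path v j : j != v ->
  exists p, [/\ path (adj G) v p, uniq (v :: p), last v p = j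
              & (size p <= #|V| - degree G v)%N].
Proof.
move=> jv; pose e := [rel x y | adj G x y && ((x == v) || ~~ adj G v y)].
have e_conn x : connect e v x.
  case/connectP: (G_conn v x) => p pv ->.
  elim/last_ind: p pv => [|p y IHp]; first by rewrite connect0.
  rewrite rcons_path last_rcons => /andP[/IHp vp py].
  have [vy|nvy] := boolP (adj G v y).
    by apply: connect1; rewrite /= vy eqxx.
  by apply: connect_trans vp (connect1 _); rewrite /= py nvy orbT.
case/connectP: (e_conn j) => p0 /shortenP[p pv up _] pj; exists p; split=> //.
  by apply: sub_path pv => x y /andP[].
case: p pv up pj => [|y q] /=; first by [].
move=> /andP[vy yq] /andP[vnin /andP[yq_uniq uq]] _.
(* [v] is counted among its own non-neighbours, which makes room for [y]. *)
have q_far : {subset v :: q <= ~: [set z | adj G v z]%SET}.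
  have far : forall s z, v \notin z :: s -> path e z s ->
      {in s, forall w, ~~ adj G v w}.
    elim=> [|w s IHs] z //= vzs /andP[/andP[_ zw] ws] u.
    rewrite inE => /predU1P[->|us].
      by case/orP: zw => // /eqP zv; rewrite zv inE eqxx in vzs.
    by apply: (IHs w) us => //; rewrite inE negb_or in vzs; case/andP: vzs.
  move=> z; rewrite inE => /predU1P[->|zq]; first by rewrite !inE adj_irr.
  by rewrite !inE; apply: (far q y).
have vq_uniq : uniq (v :: q).
  by rewrite /= uq andbT; apply: contra vnin => vq; rewrite inE vq orbT.
pose F := ~: [set z | adj G v z]%SET.
have := uniq_leq_size vq_uniq (_ : {subset v :: q <= enum F}).
rewrite -cardE cardsCs finset.setCK => -> // z zq.
by rewrite mem_enum q_far.
Qed.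

Lemma common_neighbours_ge v j :
  (degree G j <=
   #|[set z | adj G v z && adj G j z]%SET| + (#|V| - degree G v))%N.
Proof.
rewrite /degree -(cardsID [set z | adj G v z]%SET [set z | adj G j z]%SET).
apply: leq_add.
  by apply/subset_leq_card/fintype.subsetP => z; rewrite !inE andbC.
have -> : (#|V| - #|[set z | adj G v z]%SET| = #|~: [set z | adj G v z]%SET|)%N.
  by rewrite [RHS]cardsCs finset.setCK.
by apply/subset_leq_card/fintype.subsetP => z; rewrite !inE => /andP[].
Qed.

(** With [c] the number of vertices outside the neighbourhood of [v], a vertex
    of degree at least [2 * c] shares at least half of its neighbours with [v],
    so that its degree times its commute time with [v] is at most eight times the
    volume. For a vertex of smaller degree, the path of length at most [c]
    gives [4 * c ^ 2] times the volume. *)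
Lemma kemeny_le_codegree v :
  (kemeny R G <= ((8 + 4 * (#|V| - degree G v)%:R ^+ 2) * #|V|%:R)%:E)%E.
Proof.
set c := (#|V| - degree G v)%N.
have vol_ge0 := volume_ge0 R G.
apply: (@kemeny_le_commute v); first by rewrite addr_ge0 ?mulr_ge0.
move=> j hv hj jv hvP hjP; have c_ge0 := commute_ge0 G_conn hvP hjP.
have [dj|dj] := leqP (2 * c) (degree G j).
  have := commute_le_common_neighbours G_conn hvP hjP (_ : v != j).
  rewrite eq_sym => /(_ jv).
  have : (degree G j <= 2 * #|[set z | adj G v z && adj G j z]%SET|)%N.
    by have := common_neighbours_ge v j; rewrite -/c; lia.
  rewrite -(ler_nat R) natrM; set k : R := #|_|%:R => dk kc.
  have := ler_wpM2r c_ge0 dk.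
  have : 0 <= 4 * c%:R ^+ 2 * vol by rewrite !mulr_ge0.
  move: kc; lra.
have [p [pv up pj sp]] := short_path jv.
have cp := commute_le_path G_conn hvP hjP pv up pj.
move/ltnW: dj; rewrite -(ler_nat R) natrM => dj.
rewrite -(ler_nat R) -/c in sp.
apply: le_trans (ler_pM _ _ dj (le_trans cp (ler_wpM2l _ sp))) _ => //.
  by rewrite mulr_ge0.
by lra.
Qed.

End KemenyBounds.

Lemma kemeny_le_max_degree (R : realType) (n : nat) (G : sgraph 'I_n) (C : R) :
  (0 < n)%N -> graph_connected G -> n%:R - C <= (max_degree G)%:R ->
  (kemeny R G <= ((8 + 4 * C ^+ 2) * n%:R)%:E)%E.
Proof.
move=> n0 Gc hC; have V0 : (0 < #|'I_n|)%N by rewrite card_ord.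
have [v dv] := bigop.eq_bigmax (degree G) V0.
apply: le_trans (kemeny_le_codegree R Gc v) _.
rewrite card_ord lee_fin ler_wpM2r // lerD2l ler_wpM2l //.
have dn : (degree G v <= n)%N by rewrite -[leqRHS]card_ord max_card.
have cC : (n - degree G v)%:R <= C.
  by rewrite natrB //; move: hC; rewrite /max_degree dv; lra.
have c0 : 0 <= (n - degree G v)%:R :> R by [].
by rewrite lerXn2r ?nnegrE // (le_trans c0).
Qed.

(** * Asymptotics *)

(** Nonnegativity and the unboundedness of [S] exclude the limit superior -oo,
    which is not finite either. *)
Lemma bigO_on_bounded (R : realType) (S : set nat) (f : nat -> \bar R)
    (g : nat -> R) (B : R) : infinite_set S ->
  (forall n, S n -> 0 <= f n * ((g n)^-1)%:E)%E ->
  (forall n, S n -> f n * ((g n)^-1)%:E <= B%:E)%E ->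
  bigO_on S f g.
Proof.
move=> S_inf f0 fB; rewrite /bigO_on; set u := fun n => _.
have : (limf_esup u (within S \oo) <= B%:E)%E.
  apply: le_trans (ereal_inf_lbound _) (_ : ereal_sup (u @` S) <= _)%E.
    by exists S => //; apply: nearW.
  by apply: ge_ereal_sup => _ [n Sn <-]; exact: fB.
have : (0 <= limf_esup u (within S \oo))%E.
  apply: le_ereal_inf_tmp => _ [A [N _ NA] <-].
  have [n Sn Nn] : exists2 n, S n & (N <= n)%N.
    apply: contrapT => noN; apply: S_inf.
    apply: (sub_finite_set _ (finite_II N)) => n Sn /=.
    by rewrite ltnNge; apply/negP => Nn; apply: noN; exists n.
  apply: le_trans (f0 n Sn) (ereal_sup_ubound _).
  by exists n => //; apply: NA.
by case: (limf_esup _ _).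
Qed.

Theorem corollary2p7 (R : realType) (S : set nat)
  (G : forall n : nat, sgraph 'I_n)
  (S_inf : infinite_set S)
  (S_pos : forall n, S n -> (0 < n)%N)
  (G_conn : forall n, S n -> graph_connected (G n))
  (G_deg : exists C : R, forall n, S n -> n%:R - C <= (max_degree (G n))%:R) :
  bigO_on S (fun n => kemeny R (G n)) (fun n => n%:R)
  /\ ((forall n, S n -> graph_connected (compl_graph (G n))) ->
      bigO_on S
        (fun n => kemeny R (G n) * kemeny R (compl_graph (G n)))%E
        (fun n => n%:R ^+ 4)).
Proof.
have [C hC] := G_deg.
have kG n : S n -> (kemeny R (G n) <= ((8 + 4 * C ^+ 2) * n%:R)%:E)%E.
  move=> Sn.
  exact: kemeny_le_max_degree (S_pos n Sn) (G_conn n Sn) (hC n Sn).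
have n_neq0 n : S n -> n%:R != 0 :> R.
  by move=> Sn; rewrite pnatr_eq0 -lt0n S_pos.
split=> [|Gc_conn].
  apply: (bigO_on_bounded (B := 8 + 4 * C ^+ 2)) => // n Sn.
    by rewrite mule_ge0 ?kemeny_ge0 ?lee_fin ?invr_ge0 //; exact: G_conn.
  apply: le_trans (lee_wpmul2r _ (kG n Sn)) _.
    by rewrite lee_fin invr_ge0.
  by rewrite -EFinM mulfK // n_neq0.
apply: (bigO_on_bounded (B := (8 + 4 * C ^+ 2) * 2)) => // n Sn.
  rewrite mule_ge0 ?mule_ge0 ?lee_fin ?invr_ge0 ?exprn_ge0 //.
    exact: kemeny_ge0 (G_conn n Sn).
  exact: kemeny_ge0 (Gc_conn n Sn).
have K0 := kemeny_ge0 R (G_conn n Sn).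
have K0' := kemeny_ge0 R (Gc_conn n Sn).
have Kc := kemeny_le_cubic R (Gc_conn n Sn); rewrite card_ord in Kc.
apply: le_trans (lee_wpmul2r _ (lee_pmul K0 K0' (kG n Sn) Kc)) _.
  by rewrite lee_fin invr_ge0 exprn_ge0.
rewrite -!EFinM lee_fin le_eqVlt; apply/orP; left; apply/eqP.
by field; exact: n_neq0.
Qed.
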